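(* For every triangle $ABC$ lying in a plane of Euclidean space $\mathbb{R}^3$, the circumscribed sphere of the triangle is tangent to its in-lifted sphere and to its three ex-lifted spheres.
   Context: Let $ABC$ be a triangle in a plane $\pi\subset\mathbb{R}^3$. The circumscribed sphere of the triangle is the sphere having the circumscribed circle of $ABC$ as a great circle (same centre and same radius). The in-lifted sphere is the sphere of radius $r$ tangent to $\pi$ at the incenter of $ABC$, where $r$ is the inradius. For each of the three excircles, with radius $r_a$ (resp. $r_b$, $r_c$), the corresponding ex-lifted sphere is the sphere of radius $r_a$ (resp. $r_b$, $r_c$) tangent to $\pi$ at the centre of that excircle. (Each lifted sphere may be taken on either side of $\pi$.) *)

(* Defs.v *)
From HB Require Import structures.
From mathcomp Require Import all_boot all_order all_algebra.
From mathcomp Require Import boolp classical_sets reals.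

Set Implicit Arguments.
Unset Strict Implicit.
Unset Printing Implicit Defensive.

Import Order.TTheory GRing.Theory Num.Theory.
Local Open Scope ring_scope.
Local Open Scope classical_set_scope.

Notation point3 R := 'rV[R]_3.

(* The norm `|u| that MathComp-Analysis puts on row vectors is the sup norm,
   so the Euclidean one is defined here. *)
Definition dot (R : realType) (u v : point3 R) : R := (u *m v^T) 0 0.

Definition enorm (R : realType) (u : point3 R) : R := Num.sqrt (dot u u).

Definition is_plane (R : realType) (P : set (point3 R)) : Prop :=
  exists p n : point3 R, n != 0 /\ P = [set X | dot (X - p) n = 0].

Definition line (R : realType) (A B : point3 R) : set (point3 R) :=
  [set A + t *: (B - A) | t in [set: R]].

Definition segment (R : realType) (A B : point3 R) : set (point3 R) :=
  [set A + t *: (B - A) | t in [set t : R | 0 <= t <= 1]].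

Definition collinear (R : realType) (A B C : point3 R) : Prop :=
  exists D E : point3 R, [/\ D != E, line D E A, line D E B & line D E C].

Definition triangle (R : realType) (A B C : point3 R) : Prop :=
  ~ collinear A B C.

Definition sphere (R : realType) (Z : point3 R) (r : R) : set (point3 R) :=
  [set X | enorm (X - Z) = r].

(* For Z in the plane P and r > 0 this is the circle of P of centre Z and
   radius r. *)
Definition circle (R : realType) (P : set (point3 R)) (Z : point3 R) (r : R) :
  set (point3 R) := P `&` sphere Z r.

(* Tangency at X as "X is the only common point". This is meant for a circle
   and a line of its plane, a sphere and a plane, and two spheres, always with
   positive radii. Tangency of spheres may be internal or external. *)
Definition tangent_at (R : realType) (S T : set (point3 R)) (X : point3 R) :
  Prop := S `&` T = [set X].

Definition tangent (R : realType) (S T : set (point3 R)) : Prop :=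
  exists X : point3 R, tangent_at S T X.

Definition is_circumcircle (R : realType) (P : set (point3 R))
    (A B C : point3 R) (O : point3 R) (r : R) : Prop :=
  [/\ P O, 0 < r, circle P O r A, circle P O r B & circle P O r C].

Definition touches_side (R : realType) (K : set (point3 R)) (A B : point3 R) :
  Prop := exists2 X, segment A B X & tangent_at (line A B) K X.

Definition touches_extension (R : realType) (K : set (point3 R))
    (A B : point3 R) : Prop :=
  exists2 X, ~ segment A B X & tangent_at (line A B) K X.

Definition is_incircle (R : realType) (P : set (point3 R))
    (A B C : point3 R) (I : point3 R) (r : R) : Prop :=
  [/\ P I, 0 < r, touches_side (circle P I r) B C,
      touches_side (circle P I r) C A & touches_side (circle P I r) A B].

(* The excircle opposite A, the first vertex listed: it is tangent to the side
   BC and to the extensions of the other two sides. *)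
Definition is_excircle (R : realType) (P : set (point3 R))
    (A B C : point3 R) (I : point3 R) (r : R) : Prop :=
  [/\ P I, 0 < r, touches_side (circle P I r) B C,
      touches_extension (circle P I r) C A &
      touches_extension (circle P I r) A B].

Definition is_circumscribed_sphere (R : realType) (P : set (point3 R))
    (A B C : point3 R) (S : set (point3 R)) : Prop :=
  exists (O : point3 R) (r : R), is_circumcircle P A B C O r /\ S = sphere O r.

(* S is a sphere of radius r tangent to P at I. Its centre Z is one of the two
   points at distance r from I on the normal to P at I. *)
Definition lifted_sphere (R : realType) (P : set (point3 R)) (I : point3 R)
    (r : R) (S : set (point3 R)) : Prop :=
  exists Z : point3 R, S = sphere Z r /\ tangent_at S P I.

Definition is_in_lifted_sphere (R : realType) (P : set (point3 R))
    (A B C : point3 R) (S : set (point3 R)) : Prop :=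
  exists (I : point3 R) (r : R),
    is_incircle P A B C I r /\ lifted_sphere P I r S.

(* As for [is_excircle], the vertex opposite the excircle is listed first. *)
Definition is_ex_lifted_sphere (R : realType) (P : set (point3 R))
    (A B C : point3 R) (S : set (point3 R)) : Prop :=
  exists (I : point3 R) (r : R),
    is_excircle P A B C I r /\ lifted_sphere P I r S.

(* Main.v *)
Require Import Defs.
From HB Require Import structures.
From mathcomp Require Import all_boot all_order all_algebra.
From mathcomp Require Import boolp classical_sets reals.
From mathcomp Require Import ring lra.

(** Let O, rho be the circumcentre and circumradius, I, r the centre and radius
    of the in- or excircle, and Z the centre of the lifted sphere.  As Z - I is
    normal to the plane, |Z - O|^2 = r^2 + |I - O|^2, so the theorem amounts to
    Euler's relation rho^2 - |I - O|^2 = 2 rho r for the incircle, and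
    = - 2 rho r for an excircle.

    Take I as origin and let x, y, z be the contact points.  Inversion in the
    circle of centre I and radius r sends the vertices to the midpoints of the
    sides of xyz, hence the circumcircle to the nine-point circle of xyz, of
    centre N = (x + y + z) / 2 and radius r / 2.  This gives the square of
    Euler's relation.  The sign depends on whether y and z lie inside or outside
    the circumcircle, that is inside or outside the sides CA and AB. *)

Set Implicit Arguments.
Unset Strict Implicit.
Unset Printing Implicit Defensive.

Import Order.TTheory GRing.Theory Num.Theory.
Local Open Scope ring_scope.
Local Open Scope classical_set_scope.

Section EuclideanSpace.
Variable R : realType.
Implicit Types (u v w n d a b c x y z o p A B C I O X Y Z : point3 R).
Implicit Types (k r s t rho : R).

(** * Algebra of the dot product *)

Lemma dotE u v :
  dot u v = u 0 0 * v 0 0 + u 0 1 * v 0 1 + u 0 2%:R * v 0 2%:R.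
Proof.
rewrite /dot mxE !big_ord_recl big_ord0 !mxE addr0 addrA.
by congr (_ * _ + u 0 _ * v 0 _ + u 0 _ * v 0 _); apply/val_inj.
Qed.

Lemma dotC u v : dot u v = dot v u.
Proof. by rewrite !dotE; ring. Qed.

Lemma dotDl u v w : dot (u + v) w = dot u w + dot v w.
Proof. by rewrite !dotE !mxE; ring. Qed.

Lemma dotNl u w : dot (- u) w = - dot u w.
Proof. by rewrite !dotE !mxE; ring. Qed.

Lemma dotZl k u w : dot (k *: u) w = k * dot u w.
Proof. by rewrite !dotE !mxE; ring. Qed.

Lemma dotDr u v w : dot w (u + v) = dot w u + dot w v.
Proof. by rewrite !(dotC w) dotDl. Qed.

Lemma dotNr u w : dot w (- u) = - dot w u.
Proof. by rewrite !(dotC w) dotNl. Qed.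

Lemma dotZr k u w : dot w (k *: u) = k * dot w u.
Proof. by rewrite !(dotC w) dotZl. Qed.

Definition dot_lin := (dotDl, dotDr, dotNl, dotNr, dotZl, dotZr).

Lemma dot_ge0 u : 0 <= dot u u.
Proof. by rewrite dotE; nra. Qed.

Lemma dot_eq0 u : dot u u = 0 -> u = 0.
Proof.
rewrite dotE => uu0.
have sq_eq0 k : k * k = 0 -> k = 0.
  by move/eqP; rewrite mulf_eq0 orbb => /eqP.
apply/rowP => -[[|[|[|//]]] i3]; rewrite mxE.
- by rewrite (_ : Ordinal i3 = 0); [apply: sq_eq0; nra | apply/val_inj].
- by rewrite (_ : Ordinal i3 = 1); [apply: sq_eq0; nra | apply/val_inj].
- by rewrite (_ : Ordinal i3 = 2%:R); [apply: sq_eq0; nra | apply/val_inj].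
Qed.

Lemma dot_gt0 u : u != 0 -> 0 < dot u u.
Proof.
move=> u0; rewrite lt_def dot_ge0 andbT.
by apply: contra u0 => /eqP/dot_eq0 ->.
Qed.

Definition det3 u v w : R :=
  u 0 0 * (v 0 1 * w 0 2%:R - v 0 2%:R * w 0 1)
  - u 0 1 * (v 0 0 * w 0 2%:R - v 0 2%:R * w 0 0)
  + u 0 2%:R * (v 0 0 * w 0 1 - v 0 1 * w 0 0).

(** The product is the Gram determinant of [n, d, u] against [n, d, v], expanded along its first
    row; the hypotheses make that matrix diagonal. *)
Lemma det3M_perp n d u v : dot d n = 0 -> dot u n = 0 -> dot v n = 0 ->
  dot u d = 0 -> dot v d = 0 ->
  det3 n d u * det3 n d v = dot n n * dot d d * dot u v.
Proof.
move=> dn un vn ud vd.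
transitivity
  (dot n n * (dot d d * dot u v - dot v d * dot u d)
   - dot d n * (dot d n * dot u v - dot v d * dot u n)
   + dot v n * (dot d n * dot u d - dot d d * dot u n)).
  by rewrite /det3 !dotE; ring.
by rewrite dn un vn ud vd; ring.
Qed.

(** By [det3M_perp], [u] and [v] attain equality in Cauchy-Schwarz, so the difference of the two
    sides has norm 0. *)
Lemma perp_collinear n d u v : n != 0 -> d != 0 -> dot d n = 0 ->
  dot u n = 0 -> dot v n = 0 -> dot u d = 0 -> dot v d = 0 ->
  dot v v *: u = dot u v *: v.
Proof.
move=> n0 d0 dn un vn ud vd.
have nd0 : dot n n * dot d d != 0 by rewrite mulf_neq0 ?gt_eqF ?dot_gt0.
have CS : dot u u * dot v v = dot u v ^+ 2.
  apply: (mulfI nd0); apply: (mulfI nd0).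
  transitivity ((det3 n d u * det3 n d u) * (det3 n d v * det3 n d v)).
    by rewrite !det3M_perp //; ring.
  transitivity ((det3 n d u * det3 n d v) ^+ 2); first by ring.
  by rewrite det3M_perp //; ring.
apply/eqP; rewrite -subr_eq0; apply/eqP/dot_eq0.
rewrite !dot_lin (dotC v u).
transitivity (dot v v * (dot u u * dot v v - dot u v ^+ 2)); first by ring.
by rewrite CS subrr mulr0.
Qed.

(** * Spheres: tangency and power of a point *)

Lemma enorm_eqP u r : 0 <= r -> enorm u = r <-> dot u u = r ^+ 2.
Proof.
move=> r0; rewrite /enorm; split=> [<-|->].
  by rewrite sqr_sqrtr // dot_ge0.
by rewrite sqrtr_sqr ger0_norm.
Qed.

(* Otherwise the reflection of X in the hyperplane through Z orthogonal to u
   would be a second common point. *)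
Lemma tangent_sphere_perp (S : set (point3 R)) Z r X u :
  S X -> sphere Z r X -> (forall t, S (X + t *: u)) ->
  (forall Y, S Y -> sphere Z r Y -> Y = X) -> dot (X - Z) u = 0.
Proof.
move=> SX ZX Su uniqX; have [->|u0] := eqVneq u 0.
  by rewrite dotE !mxE; ring.
have uu0 := dot_gt0 u0.
pose t := - (2%:R * dot (X - Z) u / dot u u).
have tuu : t * dot u u = - (2%:R * dot (X - Z) u).
  by rewrite /t mulNr mulfVK // gt_eqF.
have : X + t *: u = X.
  apply: uniqX; first exact: Su.
  rewrite -ZX /sphere /= /enorm addrAC; congr Num.sqrt.
  move: tuu; move: (X - Z) => w tuu; rewrite !dot_lin (dotC u w) tuu; ring.
move/(congr1 (fun Y => dot (Y - X) u)) => /=.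
by rewrite addrAC subrr add0r dotZl tuu (dotE 0) !mxE; lra.
Qed.

(** Power of a point of a secant: the added term is the signed product of its distances to [A] and
    [B], nonpositive between them and nonnegative beyond. *)
Lemma chord_power A B Z s t :
  dot (A - Z) (A - Z) = s -> dot (B - Z) (B - Z) = s ->
  dot (A + t *: (B - A) - Z) (A + t *: (B - A) - Z)
  = s + t * (t - 1) * dot (B - A) (B - A).
Proof.
move=> <- BZ; have -> : A + t *: (B - A) - Z
  = (1 - t) *: (A - Z) + t *: (B - Z).
  by apply/rowP => i; rewrite !mxE; ring.
have -> : B - A = (B - Z) - (A - Z).
  by apply/rowP => i; rewrite !mxE; ring.
move: BZ; move: (A - Z) (B - Z) => a b BZ.
by rewrite !dot_lin (dotC b a) BZ; ring.
Qed.

(* [s] is a signed radius: the spheres are externally tangent for [0 < s] and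
   internally tangent for [s < 0]. *)
Lemma tangent_spheres O Z rho r s : 0 <= rho -> 0 <= r -> s ^+ 2 = r ^+ 2 ->
  Z != O -> dot (Z - O) (Z - O) = (rho + s) ^+ 2 ->
  tangent (sphere O rho) (sphere Z r).
Proof.
move=> rho0 r0 sr ZO dZO.
have e0 : rho + s != 0.
  by rewrite -sqrf_eq0 -dZO gt_eqF // dot_gt0 // subr_eq0.
set e := rho + s in e0 dZO.
(* On the line of centres, oriented so that [Z] is at signed distance [e] from [O], the contact
   point is at [rho]. *)
exists (O + (rho / e) *: (Z - O)); apply/seteqP; split => Y /=; last first.
  move=> ->; split; apply/enorm_eqP => //.
    by rewrite addrAC subrr add0r dotZl dotZr dZO; field.
  have -> : O + (rho / e) *: (Z - O) - Z = (rho / e - 1) *: (Z - O).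
    by apply/rowP => i; rewrite !mxE; ring.
  rewrite dotZl dotZr dZO -sr /e; field; exact: e0.
case=> /enorm_eqP -/(_ rho0) YO /enorm_eqP -/(_ r0) YZ.
apply/eqP; rewrite -subr_eq0; apply/eqP/dot_eq0.
(* Subtracting the sphere equations gives the radical plane; there [Y - O] and [Z - O] attain
   equality in Cauchy-Schwarz, which leaves one point. *)
have dYZ : 2%:R * dot (Y - O) (Z - O) = 2%:R * (rho * e).
  move: YZ; have -> : Y - Z = (Y - O) - (Z - O) by rewrite opprB addrA subrK.
  move: (Y - O) (Z - O) YO dZO => y z yy zz.
  rewrite !dot_lin (dotC z y) yy zz -sr /e => h; nra.
have {}dYZ : dot (Y - O) (Z - O) = rho * e by lra.
have -> : Y - (O + (rho / e) *: (Z - O)) = (Y - O) - (rho / e) *: (Z - O).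
  by rewrite opprD addrA.
move: (Y - O) (Z - O) YO dZO dYZ => y z yy zz yz.
rewrite !dot_lin (dotC z y) yy zz yz; field; exact: e0.
Qed.

(** * Euler's relation and its sign, with the incentre or excentre as origin *)

(** Within one plane, [y + z] and [a] are both orthogonal to the chord [y - z], hence parallel. *)
Lemma polar_chord n a y z k : n != 0 -> y != z ->
  dot a n = 0 -> dot y n = 0 -> dot z n = 0 ->
  dot y y = k -> dot z z = k -> dot y a = k -> dot z a = k ->
  dot a a *: (y + z) = (2%:R * k) *: a.
Proof.
move=> n0 yz an yn zn yy zz ya za.
rewrite (@perp_collinear n (y - z)) ?subr_eq0 //.
- by rewrite dotDl ya za; congr (_ *: _); ring.
- by rewrite !dot_lin yn zn; ring.
- by rewrite !dot_lin yn zn; ring.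
- by rewrite !dot_lin yy zz (dotC z y); ring.
- by rewrite !dot_lin !(dotC a) ya za; ring.
Qed.

(* The inverse [k a / |a|^2] of [a] is the midpoint of [y] and [z], so it lies
   on the nine-point circle of [x], [y], [z]. *)
Lemma inverse_nine_point a x y z k : dot a a *: (y + z) = (2%:R * k) *: a ->
  dot x x = k -> dot y a = k -> dot z a = k ->
  dot a a * (dot (x + y + z) (x + y + z) - k)
  = 4%:R * k * dot (x + y + z) a - 4%:R * k ^+ 2.
Proof.
move=> + xx; rewrite -{}xx => ayz ya za; rewrite -addrA.
move: (y + z) ayz (dotDl y z a) => v av.
rewrite {}ya {}za => va.
have vv : dot a a * dot v v = 2%:R * dot x x * (dot x x + dot x x).
  by rewrite -(dotZr _ v v) av dotZr va.
have xv : dot a a * dot x v = 2%:R * dot x x * dot x a.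
  by rewrite -dotZr av dotZr.
rewrite !dot_lin (dotC v x) va.
transitivity (2%:R * (dot a a * dot x v) + dot a a * dot v v); first by ring.
by rewrite vv xv; ring.
Qed.

(** With [v = x + y + z], the circumcircle [|u|^2 = p + 2 u.o] and the inverse nine-point circle
    [K |u|^2 = 4 r^2 u.v - 4 r^4] share [a], [b], [c], so their equations are proportional:
    [K o = 2 r^2 v] and [K p = - 4 r^4]. *)
Lemma euler_sqr n a b c x y z o rho r :
  (forall w, dot w n = 0 -> dot w (b - a) = 0 -> dot w (c - a) = 0 -> w = 0) ->
  0 < r -> dot o n = 0 -> dot x n = 0 -> dot y n = 0 -> dot z n = 0 ->
  dot x x = r ^+ 2 -> dot y y = r ^+ 2 -> dot z z = r ^+ 2 ->
  dot x b = r ^+ 2 -> dot x c = r ^+ 2 -> dot y c = r ^+ 2 ->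
  dot y a = r ^+ 2 -> dot z a = r ^+ 2 -> dot z b = r ^+ 2 ->
  dot a a *: (y + z) = (2%:R * r ^+ 2) *: a ->
  dot b b *: (z + x) = (2%:R * r ^+ 2) *: b ->
  dot c c *: (x + y) = (2%:R * r ^+ 2) *: c ->
  dot (a - o) (a - o) = rho ^+ 2 -> dot (b - o) (b - o) = rho ^+ 2 ->
  dot (c - o) (c - o) = rho ^+ 2 ->
  (rho ^+ 2 - dot o o) ^+ 2 = (2%:R * rho * r) ^+ 2.
Proof.
move=> nondeg r0 on xn yn zn xx yy zz xb xc yc ya za zb ayz bzx cxy ao bo co.
have := inverse_nine_point ayz xx ya za.
have := inverse_nine_point bzx yy zb xb.
rewrite (_ : y + z + x = x + y + z); last by rewrite addrC addrA.
have := inverse_nine_point cxy zz xc yc.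
rewrite (_ : z + x + y = x + y + z); last by rewrite -addrA addrC.
have : dot (x + y + z) n = 0 by rewrite !dotDl xn yn zn; ring.
move: (x + y + z) => v vn vc vb va.
(* [p] is minus the power of the origin for the circumcircle, [K] four times its power for the
   nine-point circle. *)
pose p := rho ^+ 2 - dot o o; pose K := dot v v - r ^+ 2.
have powE u : dot (u - o) (u - o) = rho ^+ 2 -> dot u u = p + 2%:R * dot u o.
  by rewrite /p => <-; rewrite !dot_lin (dotC o u); ring.
rewrite -/K (powE _ ao) in va; rewrite -/K (powE _ bo) in vb.
rewrite -/K (powE _ co) in vc; rewrite -/p.
(* The inverse of the nine-point circle has centre [2 r^2 v / K]. *)
have Kov : K *: o = (2%:R * r ^+ 2) *: v.
  apply/eqP; rewrite -subr_eq0; apply/eqP/nondeg.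
  - by rewrite !dot_lin on vn; ring.
  - by rewrite !dot_lin !(dotC o); lra.
  - by rewrite !dot_lin !(dotC o); lra.
have Kao : K * dot a o = 2%:R * r ^+ 2 * dot v a.
  by rewrite (dotC a) -dotZl Kov dotZl.
have Kp : K * p = - (4%:R * r ^+ 4) by lra.
have Koo : K ^+ 2 * dot o o = 4%:R * r ^+ 4 * (K + r ^+ 2).
  transitivity (dot (K *: o) (K *: o)); first by rewrite dotZl dotZr; ring.
  by rewrite Kov dotZl dotZr /K; ring.
have K0 : K != 0.
  apply/eqP => K0; have := exprn_gt0 4 r0; move: Kp; rewrite K0; lra.
apply: (mulfI (expf_neq0 2 K0)).
transitivity ((K * p) ^+ 2); first by ring.
transitivity (4%:R * r ^+ 2 * (K * (K * p) + K ^+ 2 * dot o o)).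
  by rewrite Kp Koo; ring.
by rewrite /p; ring.
Qed.

(* Adding the two last hypotheses and eliminating [y + z] gives
   [p * (dot a a - k) >= 0], where [p = rho ^+ 2 - dot o o]. *)
Lemma in_power_ge0 a y z o rho k : 0 < k -> y != z ->
  dot y y = k -> dot z z = k -> dot y a = k -> dot z a = k ->
  dot a a *: (y + z) = (2%:R * k) *: a -> dot (a - o) (a - o) = rho ^+ 2 ->
  dot (y - o) (y - o) <= rho ^+ 2 -> dot (z - o) (z - o) <= rho ^+ 2 ->
  0 <= rho ^+ 2 - dot o o.
Proof.
move=> k0 yz yy zz ya za ayz ao yo zo.
(* Equality would make both contact points equal to [a]. *)
have ak : k < dot a a.
  have distE u : dot u u = k -> dot u a = k ->
      dot (a - u) (a - u) = dot a a - k.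
    by move=> uu ua; rewrite !dot_lin (dotC a u) uu ua; ring.
  have ak : k <= dot a a by rewrite -subr_ge0 -(distE y) ?dot_ge0.
  rewrite lt_neqAle ak andbT; apply: contra yz => /eqP ka.
  have foot u : dot u u = k -> dot u a = k -> a = u.
    move=> uu ua; apply/eqP; rewrite -subr_eq0; apply/eqP/dot_eq0.
    by rewrite distE // ka subrr.
  by rewrite -(foot y) // -(foot z).
have := congr1 (dot o) ayz; rewrite /= !dotZr dotDr.
move: ao yo zo; rewrite !dot_lin !(dotC _ o) yy zz; nra.
Qed.

(** The elimination of [in_power_ge0] now gives [p * (dot a a - k) < 0], so that [k <= dot a a]
    suffices. *)
Lemma ex_power_lt0 a y z o rho k : 0 < k ->
  dot y y = k -> dot z z = k -> dot y a = k -> dot z a = k ->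
  dot a a *: (y + z) = (2%:R * k) *: a -> dot (a - o) (a - o) = rho ^+ 2 ->
  rho ^+ 2 < dot (y - o) (y - o) -> rho ^+ 2 < dot (z - o) (z - o) ->
  rho ^+ 2 - dot o o < 0.
Proof.
move=> k0 yy zz ya za ayz ao yo zo.
have ak : k <= dot a a.
  have := dot_ge0 (a - y); rewrite !dot_lin (dotC a y) yy ya; lra.
have := congr1 (dot o) ayz; rewrite /= !dotZr dotDr.
move: ao yo zo; rewrite !dot_lin !(dotC _ o) yy zz; nra.
Qed.

(** * Triangles and points on their side lines *)

Lemma triangle_rot A B C : triangle A B C -> triangle B C A.
Proof. by move=> ABC [D [E [DE DB DC DA]]]; apply: ABC; exists D, E. Qed.

Lemma triangle_neq A B C : triangle A B C -> A != B.
Proof.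
move=> ABC; apply/eqP => AB; apply: ABC; rewrite -{B}AB.
have lineP D E t : line D E (D + t *: (E - D)) by exists t.
have lineL (D E : point3 R) : line D E D.
  by have := lineP D E 0; rewrite scale0r addr0.
have [CA|CA] := eqVneq C A; last first.
  exists A, C; split; rewrite 1?eq_sym //.
  by have := lineP A C 1; rewrite scale1r addrC subrK.
rewrite {}CA; exists A, (A + const_mx 1); split=> //.
apply/eqP => /(congr1 (fun u => u 0 0)); rewrite !mxE; lra.
Qed.

(** A nonzero [w] would make both sides from [A] parallel by [perp_collinear]. *)
Lemma triangle_nondegenerate n A B C w : n != 0 -> triangle A B C ->
  dot (B - A) n = 0 -> dot (C - A) n = 0 -> dot w n = 0 ->
  dot w (B - A) = 0 -> dot w (C - A) = 0 -> w = 0.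
Proof.
move=> n0 ABC ABn ACn wn wAB wAC; have [//|w0] := eqVneq w 0.
have AB := triangle_neq ABC.
case: ABC; exists A, B; split=> //.
- by exists 0; rewrite // scale0r addr0.
- by exists 1; rewrite // scale1r addrC subrK.
rewrite (dotC w) in wAB; rewrite (dotC w) in wAC.
have AB0 : dot (B - A) (B - A) != 0.
  by rewrite gt_eqF // dot_gt0 // subr_eq0 eq_sym.
exists (dot (C - A) (B - A) / dot (B - A) (B - A)) => //.
apply/eqP; rewrite addrC eq_sym -subr_eq; apply/eqP/(scalerI AB0).
by rewrite (perp_collinear n0 w0) // scalerA mulrCA divff ?mulr1.
Qed.

Lemma segment_power A B X O k :
  dot (A - O) (A - O) = k -> dot (B - O) (B - O) = k ->
  segment A B X -> dot (X - O) (X - O) <= k.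
Proof.
move=> AO BO [t /= t01 <-]; rewrite (chord_power _ AO BO).
case/andP: t01 => t0 t1.
by rewrite gerDl mulr_le0_ge0 ?dot_ge0 // mulr_ge0_le0 // subr_le0.
Qed.

Lemma extension_power A B X O k : A != B ->
  dot (A - O) (A - O) = k -> dot (B - O) (B - O) = k ->
  line A B X -> ~ segment A B X -> k < dot (X - O) (X - O).
Proof.
move=> AB AO BO [t _ <-] nseg; rewrite (chord_power _ AO BO).
have AB0 : 0 < dot (B - A) (B - A) by rewrite dot_gt0 // subr_eq0 eq_sym.
suff tt : 0 < t * (t - 1) by rewrite ltrDl mulr_gt0.
have [t0|t0] := ltP t 0; first by rewrite nmulr_rgt0 // subr_lt0 (lt_trans t0).
have [t1|t1] := ltP 1 t; first by rewrite mulr_gt0 ?subr_gt0 // (lt_trans _ t1).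
by case: nseg; exists t; rewrite //= t0 t1.
Qed.

(** * Metric consequences of the tangency hypotheses *)

Definition plane p n : set (point3 R) := [set X | dot (X - p) n = 0].

Lemma plane_dir p n X Y : plane p n X -> plane p n Y -> dot (X - Y) n = 0.
Proof. by rewrite /plane /= !dot_lin; lra. Qed.

(** The radius [X - I] is orthogonal to the tangent line, so its product with [V - I] is the same
    for every [V] on that line as for [X]. *)
Lemma contact_dot p n I A B X r : 0 < r ->
  plane p n A -> plane p n B ->
  tangent_at (line A B) (circle (plane p n) I r) X ->
  [/\ line A B X, plane p n X, dot (X - I) (X - I) = r ^+ 2,
      dot (X - I) (A - I) = r ^+ 2 & dot (X - I) (B - I) = r ^+ 2].
Proof.
move=> r0 PA PB tX.
have [lX [PX IX]] : (line A B `&` circle (plane p n) I r) X by rewrite tX.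
have XX : dot (X - I) (X - I) = r ^+ 2 by apply/enorm_eqP; rewrite // ltW.
have lineD t : line A B (X + t *: (B - A)).
  by case: lX => s _ <-; exists (s + t); rewrite // scalerDl addrA.
have perp : dot (X - I) (B - A) = 0.
  (* Moving the plane from the circle to the line leaves a sphere. *)
  apply: (@tangent_sphere_perp (line A B `&` plane p n) I r) => //.
    move=> t; split=> //; move: PX PA PB; rewrite /plane /= !dot_lin => *; nra.
  move=> Y [lY PY] IY.
  suff : [set X] Y by [].
  by rewrite -tX.
case: lX => t _ Xt.
have AX : A - I = (X - I) - t *: (B - A).
  by rewrite -Xt; apply/rowP => i; rewrite !mxE; ring.
have BX : B - I = (X - I) + (1 - t) *: (B - A).
  by rewrite -Xt; apply/rowP => i; rewrite !mxE; ring.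
split=> //; first by exists t.
- by rewrite AX dotDr dotNr dotZr perp XX; ring.
- by rewrite BX dotDr dotZr perp XX; ring.
Qed.

Lemma lifted_center_dot p n I r T O : 0 < r -> plane p n I -> plane p n O ->
  lifted_sphere (plane p n) I r T -> exists Z, [/\ T = sphere Z r, Z != O &
    dot (Z - O) (Z - O) = r ^+ 2 + dot (O - I) (O - I)].
Proof.
move=> r0 PI PO [Z [-> tI]]; exists Z.
have [ZI _] : (sphere Z r `&` plane p n) I by rewrite tI.
have II : dot (I - Z) (I - Z) = r ^+ 2 by apply/enorm_eqP; rewrite // ltW.
have perp : dot (I - Z) (O - I) = 0.
  apply: (@tangent_sphere_perp (plane p n) Z r) => //.
    move=> t; move: PI PO; rewrite /plane /= !dot_lin => *; nra.
  move=> Y PY ZY; suff : [set I] Y by [].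
  by rewrite -tI.
have ZO : dot (Z - O) (Z - O) = r ^+ 2 + dot (O - I) (O - I).
  have -> : Z - O = - ((I - Z) + (O - I)).
    by apply/rowP => i; rewrite !mxE; ring.
  move: (I - Z) (O - I) II perp => u v uu uv.
  by rewrite !dot_lin (dotC v u) uv uu; ring.
split=> //; apply/eqP => ZOe; move: ZO; rewrite ZOe subrr.
have := dot_ge0 (O - I); have := exprn_gt0 2 r0.
by rewrite (dotE 0) !mxE; lra.
Qed.

(** The incircle and the excircle opposite [A] share the squared relation. The power of [Y] and [Z]
    for the circumcircle is nonpositive on the sides and positive on the extensions, which selects
    the root. *)
Lemma euler_relation p n A B C O rho I r X Y Z : n != 0 ->
  plane p n A -> plane p n B -> plane p n C -> triangle A B C ->
  is_circumcircle (plane p n) A B C O rho -> plane p n I -> 0 < r ->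
  tangent_at (line B C) (circle (plane p n) I r) X ->
  tangent_at (line C A) (circle (plane p n) I r) Y ->
  tangent_at (line A B) (circle (plane p n) I r) Z ->
  let q := rho ^+ 2 - dot (O - I) (O - I) in
  [/\ segment C A Y -> segment A B Z -> q = 2%:R * rho * r &
      ~ segment C A Y -> ~ segment A B Z -> q = - (2%:R * rho * r)].
Proof.
move=> n0 PA PB PC ABC [PO rho0 [_ OA] [_ OB] [_ OC]] PI r0 tX tY tZ q.
have sqO V : sphere O rho V -> dot (V - O) (V - O) = rho ^+ 2.
  by move=> OV; apply/enorm_eqP; rewrite // ltW.
move/sqO: OA => OA; move/sqO: OB => OB; move/sqO: OC => OC {sqO}.
have [lX PX xx xb xc] := contact_dot r0 PB PC tX.
have [lY PY yy yc ya] := contact_dot r0 PC PA tY.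
have [lZ PZ zz za zb] := contact_dot r0 PA PB tZ.
have r2 : 0 < r ^+ 2 by apply: exprn_gt0.
have BCA := triangle_rot ABC; have CAB := triangle_rot BCA.
have shift (V W U : point3 R) : V - W = (V - U) - (W - U).
  by rewrite opprB addrA subrK.
have dirI V : plane p n V -> dot (V - I) n = 0 by move=> /plane_dir; apply.
(* Equal contact points on two sides would make the radius to them orthogonal
   to both sides. *)
have neq (U V W S T : point3 R) : triangle U V W ->
    plane p n U -> plane p n V -> plane p n W -> plane p n S ->
    dot (S - I) (S - I) = r ^+ 2 ->
    dot (S - I) (W - I) = r ^+ 2 -> dot (S - I) (U - I) = r ^+ 2 ->
    dot (T - I) (U - I) = r ^+ 2 -> dot (T - I) (V - I) = r ^+ 2 ->
    S - I != T - I.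
  move=> UVW PU PV PW PS ss sw su tu tv; apply/eqP => ST; move: r2.
  have s0 : S - I = 0.
    apply: (triangle_nondegenerate n0 UVW);
      rewrite ?(plane_dir (p := p) (n := n)) //.
    - by rewrite ST (shift V U I) dotDr dotNr tu tv subrr.
    - by rewrite (shift W U I) dotDr dotNr su sw subrr.
  by rewrite -ss s0 (dotE 0) !mxE; lra.
have yz := neq _ _ _ _ _ ABC PA PB PC PY yy yc ya za zb.
have zx := neq _ _ _ _ _ BCA PB PC PA PZ zz za zb xb xc.
have xy := neq _ _ _ _ _ CAB PC PA PB PX xx xb xc yc ya.
have ayz := polar_chord n0 yz (dirI _ PA) (dirI _ PY) (dirI _ PZ) yy zz ya za.
have bzx := polar_chord n0 zx (dirI _ PB) (dirI _ PZ) (dirI _ PX) zz xx zb xb.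
have cxy := polar_chord n0 xy (dirI _ PC) (dirI _ PX) (dirI _ PY) xx yy xc yc.
(* The copies are translated to the origin [I]; the originals serve for the power of [Y] and [Z]. *)
have OAI := OA; have OBI := OB; have OCI := OC.
rewrite (shift A O I) in OAI; rewrite (shift B O I) in OBI.
rewrite (shift C O I) in OCI.
have : q ^+ 2 = (2%:R * rho * r) ^+ 2.
  apply: (@euler_sqr n (A - I) (B - I) (C - I) (X - I) (Y - I) (Z - I));
    rewrite ?dirI //.
  move=> w wn; rewrite -!shift => wb wc.
  by apply: (triangle_nondegenerate n0 ABC);
    rewrite ?(plane_dir (p := p) (n := n)).
move/eqP; rewrite eqf_sqr => q2; have rr0 := mulr_gt0 rho0 r0.
split=> [sY sZ|sY sZ].
- have := segment_power OC OA sY; have := segment_power OA OB sZ.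
  rewrite (shift Y O I) (shift Z O I) => oz oy.
  have := in_power_ge0 r2 yz yy zz ya za ayz OAI oy oz; rewrite -/q.
  by case/orP: q2 => /eqP ->; lra.
- have CA := triangle_neq CAB; have AB := triangle_neq ABC.
  have := extension_power CA OC OA lY sY.
  have := extension_power AB OA OB lZ sZ.
  rewrite (shift Y O I) (shift Z O I) => oz oy.
  have := ex_power_lt0 r2 yy zz ya za ayz OAI oy oz; rewrite -/q.
  by case/orP: q2 => /eqP ->; lra.
Qed.

(** * Tangency of the lifted spheres *)

(** Euler's relation turns [r^2 + |O - I|^2] into [(rho - r)^2]: internal tangency, with signed
    radius [- r]. *)
Lemma in_lifted_tangent p n A B C S T : n != 0 ->
  plane p n A -> plane p n B -> plane p n C -> triangle A B C ->
  is_circumscribed_sphere (plane p n) A B C S ->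
  is_in_lifted_sphere (plane p n) A B C T -> tangent S T.
Proof.
move=> n0 PA PB PC ABC [O [rho [circO ->]]].
move=> [I [r [[PI r0 [X _ tX] [Y sY tY] [Z sZ tZ]] liftT]]].
have [PO rho0 _ _ _] := circO.
have [/(_ sY sZ) euler _] :=
  euler_relation n0 PA PB PC ABC circO PI r0 tX tY tZ.
have [V [-> VO dVO]] := lifted_center_dot r0 PI PO liftT.
apply: (@tangent_spheres O V rho r (- r));
  rewrite ?sqrrN ?(ltW rho0) ?(ltW r0) //.
rewrite dVO; lra.
Qed.

(** Here the sum becomes [(rho + r)^2]: external tangency. *)
Lemma ex_lifted_tangent p n A B C S T : n != 0 ->
  plane p n A -> plane p n B -> plane p n C -> triangle A B C ->
  is_circumscribed_sphere (plane p n) A B C S ->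
  is_ex_lifted_sphere (plane p n) A B C T -> tangent S T.
Proof.
move=> n0 PA PB PC ABC [O [rho [circO ->]]].
move=> [I [r [[PI r0 [X _ tX] [Y sY tY] [Z sZ tZ]] liftT]]].
have [PO rho0 _ _ _] := circO.
have [_ /(_ sY sZ) euler] :=
  euler_relation n0 PA PB PC ABC circO PI r0 tX tY tZ.
have [V [-> VO dVO]] := lifted_center_dot r0 PI PO liftT.
apply: (@tangent_spheres O V rho r r); rewrite ?(ltW rho0) ?(ltW r0) //.
rewrite dVO; lra.
Qed.

(** Rotation brings each vertex to the first place, where [ex_lifted_tangent] applies. *)
Lemma circumscribed_rot (P : set (point3 R)) A B C S :
  is_circumscribed_sphere P A B C S -> is_circumscribed_sphere P B C A S.
Proof. by case=> O [r [[PO r0 OA OB OC] ->]]; exists O, r. Qed.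

End EuclideanSpace.

Theorem mainTheorem4 (R : realType) (P : set (point3 R)) (A B C : point3 R) :
  is_plane P -> P A -> P B -> P C -> triangle A B C ->
  forall S : set (point3 R), is_circumscribed_sphere P A B C S ->
  [/\ forall T, is_in_lifted_sphere P A B C T -> tangent S T,
      forall T, is_ex_lifted_sphere P A B C T -> tangent S T,
      forall T, is_ex_lifted_sphere P B C A T -> tangent S T &
      forall T, is_ex_lifted_sphere P C A B T -> tangent S T].
Proof.
move=> [p [n [n0 ->]]] PA PB PC ABC S cS.
have BCA := triangle_rot ABC; have CAB := triangle_rot BCA.
have cS' := circumscribed_rot cS; have cS'' := circumscribed_rot cS'.
split=> T.
- exact: (in_lifted_tangent n0 PA PB PC).
- exact: (ex_lifted_tangent n0 PA PB PC).
- exact: (ex_lifted_tangent n0 PB PC PA).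
- exact: (ex_lifted_tangent n0 PC PA PB).
Qed.
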